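(* Let $K$ be a field containing a primitive eighth root of unity $\xi$, put $\iota=\xi^2$, and let $\zeta\in K$ satisfy $\zeta^4=1$. Let $A$ be the commutative algebra over $K$ generated by two commuting variables $x,y$ subject to $x^4=1$ and $y^2=\frac12(1+\zeta x+x^2-\zeta x^3)$, with the coproduct and counit described in the context. Define $\omega_1=1$, \[\omega_2=\tfrac12(1+\iota\zeta^2)x+\tfrac12(1-\iota\zeta^2)x^3,\qquad \omega_3=\tfrac12(1-\iota\zeta^2)x+\tfrac12(1+\iota\zeta^2)x^3,\] $\omega_4=x^2$, $\eta_1=y$, $\eta_2=x^3y$, $\eta_3=x^2y$, $\eta_4=xy$. Then the elements $\omega_1,\omega_2,\omega_3,\omega_4,\eta_1,\eta_2,\eta_3,\eta_4$ form a basis of $A$, and they are group-like.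
   Context: Let $G=\mathbb{Z}_2\times\mathbb{Z}_2$ with elements $g_1=(0,0)$, $g_2=(1,0)$, $g_3=(0,1)$, $g_4=(1,1)$, and let $H=K[G]$. $G$ acts on $A$ by algebra automorphisms: $g_2$ acts by $\phi$ with $\phi(x)=x^3$, $\phi(y)=x^3y$; $g_3$ acts by $\phi'$ with $\phi'(x)=x$, $\phi'(y)=x^2y$; $g_4$ acts by $\phi\circ\phi'$. Let $\theta:G\times G\to K^\times$ be the symmetric bicharacter with $\theta(g_2,g_2)=\zeta^2$, $\theta(g_2,g_3)=\theta(g_3,g_2)=-1$, $\theta(g_3,g_3)=1$. The coaction is $\delta:A\to H\otimes A$, $\delta(a)=a^{(1)}\otimes a^{(2)}=\frac14\sum_{g,g'\in G}\theta(g,g')\,g\otimes g'.a$. $A\hat\otimes A$ denotes $A\otimes A$ with the product $(a\otimes b)(a'\otimes b')=a(b^{(1)}.a')\otimes b^{(2)}b'$. The coproduct is the unique algebra homomorphism $\Delta_A:A\to A\hat\otimes A$ with $\Delta_A(x)=\frac12(x\otimes x+x\otimes x^3+x^3\otimes x-x^3\otimes x^3)$ and $\Delta_A(y)=y\otimes y$. The counit is the algebra homomorphism $\varepsilon_A:A\to K$ with $\varepsilon_A(x)=\varepsilon_A(y)=1$. An element $a$ is group-like if $\Delta_A(a)=a\otimes a$ and $\varepsilon_A(a)=1$. *)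

(* Defs.v *)
From HB Require Import structures.
From mathcomp Require Import all_boot all_order all_algebra.

Set Implicit Arguments.
Unset Strict Implicit.
Unset Printing Implicit Defensive.

Import GRing.Theory.
Local Open Scope ring_scope.

(* {poly {poly K}} plays the role of K[X,Y]: 'X%:P is X and 'X is Y. *)
Definition eval2 (K : fieldType) (A : comAlgType K) (x y : A)
    (P : {poly {poly K}}) : A :=
  (map_poly (horner_alg x) P).[y].

Definition rel_x (K : fieldType) : {poly {poly K}} := 'X%:P ^+ 4 - 1.

Definition rel_y (K : fieldType) (zeta : K) : {poly {poly K}} :=
  'X ^+ 2 - (2^-1 *: (1 + zeta *: 'X + 'X^2 - zeta *: 'X^3))%:P.

(* Evaluation at (x, y) induces an isomorphism K[X,Y] / (rel_x, rel_y) ~ A. *)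
Definition is_presented (K : fieldType) (zeta : K) (A : comAlgType K)
    (x y : A) : Prop :=
  (forall a : A, exists P, a = eval2 x y P) /\
  (forall P, eval2 x y P = 0 <->
     exists U V, P = U * rel_x K + V * rel_y zeta).

(* Additive notation is used for the Klein four-group. *)
Notation V4 := ('Z_2 * 'Z_2)%type.
Definition g1 : V4 := (0, 0).
Definition g2 : V4 := (1, 0).
Definition g3 : V4 := (0, 1).
Definition g4 : V4 := (1, 1).

Definition is_V4_action (K : fieldType) (A : comAlgType K) (x y : A)
    (act : V4 -> {lrmorphism A -> A}) : Prop :=
  [/\ act g1 =1 id,
      act g2 x = x ^+ 3 /\ act g2 y = x ^+ 3 * y,
      act g3 x = x /\ act g3 y = x ^+ 2 * y,
      act g4 =1 act g2 \o act g3
    & forall (g h : V4) (a : A), act (g + h) a = act g (act h a)].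

Definition is_sym_bicharacter (K : fieldType) (theta : V4 -> V4 -> K) : Prop :=
  [/\ forall g h, theta g h != 0,
      forall g h, theta g h = theta h g,
      forall g g' h, theta (g + g') h = theta g h * theta g' h
    & forall g h h', theta g (h + h') = theta g h * theta g h'].

Definition theta_values (K : fieldType) (zeta : K)
    (theta : V4 -> V4 -> K) : Prop :=
  [/\ theta g2 g2 = zeta ^+ 2,
      theta g2 g3 = -1, theta g3 g2 = -1
    & theta g3 g3 = 1].

(* As K[V4] has basis V4, an element of K[V4] (x) A is written uniquely as
   \sum_g g (x) a_g, and is encoded by the family (a_g)_g. *)
Definition coaction (K : fieldType) (A : comAlgType K)
    (act : V4 -> {lrmorphism A -> A}) (theta : V4 -> V4 -> K)
    (a : A) : {ffun V4 -> A} :=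
  [ffun g => 4^-1 *: \sum_(g' : V4) theta g g' *: act g' a].

Definition is_tensor_product (K : fieldType) (U V T : lmodType K)
    (tens : {bilinear U -> V -> T}) : Prop :=
  forall (W : lmodType K) (f : {bilinear U -> V -> W}),
    exists F : {linear T -> W},
      (forall u v, F (tens u v) = f u v) /\
      (forall F' : {linear T -> W},
         (forall u v, F' (tens u v) = f u v) -> F' =1 F).

(* (a (x) b)(a' (x) b') = a (b^(1).a') (x) b^(2) b', where
   b^(1) (x) b^(2) = \sum_g g (x) coaction act theta b g. *)
Definition is_braided_product (K : fieldType) (A : comAlgType K)
    (act : V4 -> {lrmorphism A -> A}) (theta : V4 -> V4 -> K)
    (AA : algType K) (tens : {bilinear A -> A -> AA}) : Prop :=
  forall a b a' b' : A,
    tens a b * tens a' b' =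
    \sum_(g : V4) tens (a * act g a') (coaction act theta b g * b').

Definition is_coproduct (K : fieldType) (A : comAlgType K) (x y : A)
    (AA : algType K) (tens : {bilinear A -> A -> AA})
    (Delta : {lrmorphism A -> AA}) : Prop :=
  Delta x = 2^-1 *: (tens x x + tens x (x ^+ 3) + tens (x ^+ 3) x
                     - tens (x ^+ 3) (x ^+ 3)) /\
  Delta y = tens y y.

Definition is_counit (K : fieldType) (A : comAlgType K) (x y : A)
    (eps : {lrmorphism A -> K^o}) : Prop :=
  eps x = 1 /\ eps y = 1.

Definition group_like (K : fieldType) (A : comAlgType K)
    (AA : algType K) (tens : {bilinear A -> A -> AA})
    (Delta : {lrmorphism A -> AA}) (eps : {lrmorphism A -> K^o})
    (a : A) : Prop :=
  Delta a = tens a a /\ eps a = 1.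

(* vector.v's basis_of would require A to be known to be finite-dimensional. *)
Definition is_basis (K : fieldType) (V : lmodType K) (n : nat)
    (b : 'I_n -> V) : Prop :=
  (forall c : 'I_n -> K, \sum_(i < n) c i *: b i = 0 -> forall i, c i = 0) /\
  (forall v : V, exists c : 'I_n -> K, v = \sum_(i < n) c i *: b i).

Section Elements.
Variables (K : fieldType) (A : comAlgType K) (iota zeta : K) (x y : A).

Definition omega1 : A := 1.
Definition omega2 : A := (2^-1 * (1 + iota * zeta ^+ 2)) *: x
                         + (2^-1 * (1 - iota * zeta ^+ 2)) *: x ^+ 3.
Definition omega3 : A := (2^-1 * (1 - iota * zeta ^+ 2)) *: x
                         + (2^-1 * (1 + iota * zeta ^+ 2)) *: x ^+ 3.
Definition omega4 : A := x ^+ 2.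
Definition eta1 : A := y.
Definition eta2 : A := x ^+ 3 * y.
Definition eta3 : A := x ^+ 2 * y.
Definition eta4 : A := x * y.

Definition omega_eta : 8.-tuple A :=
  [tuple omega1; omega2; omega3; omega4; eta1; eta2; eta3; eta4].

End Elements.

(* Main.v *)
(* Dividing by the two relations, monic in Y and X respectively, shows that the
   monomials x^i y^j with i < 4 and j < 2 form a basis of A; on the span of x
   and x^3 the passage to omega_2, omega_3 is invertible.
   Set p = (x + x^3)/2 and m = (x - x^3)/2: both are fixed by g_3, while g_2
   fixes p and negates m, so by nondegeneracy of theta the coaction is
   p |-> g_1 (x) p and m |-> g_3 (x) m.  Hence multiplying in the braided
   product by a (x) p is the ordinary product, and multiplying by a (x) m only
   twists by g_3.  As Delta(x) = x (x) p + x^3 (x) m, with pm = 0 and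
   p^2 + m^2 = x^2, every group-like identity follows by direct
   multiplication. *)

Require Import Defs.
From HB Require Import structures.
From mathcomp Require Import all_boot all_order all_algebra.
From mathcomp Require Import ring.
Import GRing.Theory.
Local Open Scope ring_scope.

Lemma eval2D {K : fieldType} {A : comAlgType K} (x y : A)
    (P Q : {poly {poly K}}) :
  eval2 x y (P + Q) = eval2 x y P + eval2 x y Q.
Proof. by rewrite /eval2 rmorphD hornerD. Qed.

Lemma eval2M {K : fieldType} {A : comAlgType K} (x y : A)
    (P Q : {poly {poly K}}) :
  eval2 x y (P * Q) = eval2 x y P * eval2 x y Q.
Proof. by rewrite /eval2 rmorphM hornerM. Qed.

Lemma eval2C {K : fieldType} {A : comAlgType K} (x y : A) (p : {poly K}) :
  eval2 x y p%:P = horner_alg x p.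
Proof. by rewrite /eval2 map_polyC hornerC. Qed.

Lemma eval2_linear {K : fieldType} {A : comAlgType K} (x y : A)
    (p q : {poly K}) :
  eval2 x y (p%:P + q%:P * 'X) = horner_alg x p + horner_alg x q * y.
Proof. by rewrite eval2D eval2M !eval2C /eval2 map_polyX hornerX. Qed.

Lemma horner_alg_wide {K : fieldType} {A : comAlgType K} (x : A) (n : nat)
    (p : {poly K}) :
  (size p <= n)%N -> horner_alg x p = \sum_(i < n) p`_i *: x ^+ i.
Proof.
move=> szp; rewrite [LHS](@horner_coef_wide _ n) ?size_map_poly //.
by apply: eq_bigr => i _; rewrite coef_map mulr_algl.
Qed.

Lemma rel_xE (K : fieldType) : rel_x K = ('X^4 - 1)%:P.
Proof. by rewrite /rel_x rmorphB rmorphXn. Qed.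

Lemma rel_y_monic {K : fieldType} (zeta : K) : rel_y zeta \is monic.
Proof. exact: monicXnsubC. Qed.

Lemma size_rel_y {K : fieldType} (zeta : K) : size (rel_y zeta) = 3%N.
Proof. exact: size_XnsubC. Qed.

Lemma linear_in_ideal {K : fieldType} {zeta : K} (U V P : {poly {poly K}}) :
    (size P <= 2)%N -> P = U * rel_x K + V * rel_y zeta ->
  exists W, P = ('X^4 - 1) *: W.
Proof.
move=> szP defP; have mon := rel_y_monic zeta.
exists (Pdiv.Ring.rmodp U (rel_y zeta)).
have small (Q : {poly {poly K}}) :
    (size Q <= 2)%N -> Pdiv.Ring.rmodp Q (rel_y zeta) = Q.
  by move=> szQ; rewrite Pdiv.Ring.rmodp_small // size_rel_y.
rewrite -[LHS]small // {}defP Pdiv.RingMonic.rmodpD //.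
rewrite Pdiv.RingMonic.rmodp_mull // addr0.
by rewrite rel_xE mulrC mul_polyC Pdiv.RingMonic.rmodpZ.
Qed.

Lemma presented_inj {K : fieldType} {zeta : K} {A : comAlgType K} {x y : A}
    (A_pres : is_presented zeta x y) (p q : {poly K}) :
    (size p <= 4)%N -> (size q <= 4)%N ->
    horner_alg x p + horner_alg x q * y = 0 ->
  p = 0 /\ q = 0.
Proof.
move=> szp szq; rewrite -eval2_linear => /(proj2 A_pres _) [U [V defP]].
have [|W defW] := linear_in_ideal _ _ _ _ defP.
  rewrite (leq_trans (size_polyD _ _)) // geq_max.
  rewrite (leq_trans (size_polyC_leq1 _)) //=.
  by rewrite mul_polyC (leq_trans (size_scale_leq _ _)) ?size_polyX.
have annul (r w : {poly K}) : (size r <= 4)%N -> r = ('X^4 - 1) * w -> r = 0.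
  move=> szr defr; apply/eqP; apply: contraLR szr => nz_r.
  have nz_w: w != 0 by apply: contraNneq nz_r => w0; rewrite defr w0 mulr0.
  have mon4: 'X^4 - 1 \is @monic K by apply: monicXnsubC.
  rewrite -ltnNge defr size_monicM // size_XnsubC //.
  by rewrite -[size w]prednK ?size_poly_gt0.
have coefW i : (p%:P + q%:P * 'X)`_i = ('X^4 - 1) * W`_i by rewrite defW coefZ.
split.
  by apply: (annul _ W`_0 szp); rewrite -(coefW 0%N) coefD coefC coefMX addr0.
apply: (annul _ W`_1 szq).
by rewrite -(coefW 1%N) coefD coefC coefMX coefC add0r.
Qed.

Lemma presented_rel_x {K : fieldType} {zeta : K} {A : comAlgType K} {x y : A}
    (A_pres : is_presented zeta x y) : x ^+ 4 = 1.
Proof.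
have : eval2 x y (rel_x K) = 0.
  by apply/(proj2 A_pres _); exists 1, 0; rewrite mul1r mul0r addr0.
rewrite rel_xE eval2C rmorphB rmorphXn /= horner_algX rmorph1.
by move/eqP; rewrite subr_eq0 => /eqP.
Qed.

Lemma presented_span {K : fieldType} {zeta : K} {A : comAlgType K} {x y : A}
    (A_pres : is_presented zeta x y) (a : A) :
  exists p q : {poly K}, [/\ (size p <= 4)%N, (size q <= 4)%N
    & a = horner_alg x p + horner_alg x q * y].
Proof.
have [P ->] := proj1 A_pres a.
pose R := Pdiv.Ring.rmodp P (rel_y zeta).
have szR : (size R <= 2)%N.
  by rewrite -ltnS -(size_rel_y zeta) Pdiv.Ring.ltn_rmodpN0 // monic_neq0
             ?rel_y_monic.
have evP : eval2 x y P = eval2 x y R.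
  rewrite [P](Pdiv.RingMonic.rdivp_eq (rel_y_monic zeta)) eval2D.
  rewrite (proj2 (proj2 A_pres _)) ?add0r //.
  by exists 0, (Pdiv.Ring.rdivp P (rel_y zeta)); rewrite mul0r add0r.
have defR : R = (R`_0)%:P + (R`_1)%:P * 'X.
  apply/polyP => i; rewrite coefD coefC coefMX coefC.
  case: i => [|[|i]]; rewrite /= ?addr0 ?add0r //.
  by rewrite nth_default // (leq_trans szR).
have mon4 : 'X^4 - 1 \is @monic K by apply: monicXnsubC.
have red (p : {poly K}) :
    horner_alg x p = horner_alg x (Pdiv.Ring.rmodp p ('X^4 - 1)).
  rewrite {1}[p](Pdiv.RingMonic.rdivp_eq mon4) rmorphD rmorphM rmorphB rmorphXn.
  rewrite /= horner_algX rmorph1.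
  by rewrite (presented_rel_x A_pres) subrr mulr0 add0r.
have szred (p : {poly K}) : (size (Pdiv.Ring.rmodp p ('X^4 - 1)) <= 4)%N.
  by rewrite -ltnS -[5%N](size_XnsubC (1 : K) (isT : 0 < 4)%N)
             Pdiv.Ring.ltn_rmodpN0 ?monic_neq0.
exists (Pdiv.Ring.rmodp R`_0 ('X^4 - 1)), (Pdiv.Ring.rmodp R`_1 ('X^4 - 1)).
by split=> //; rewrite evP {1}defR eval2_linear -!red.
Qed.

Lemma prim8_expr4 {K : fieldType} {xi : K} :
  8.-primitive_root xi -> xi ^+ 4 = -1.
Proof.
move=> prim; have neq1 : xi ^+ 4 != 1.
  by rewrite -(expr0 xi) (eq_prim_root_expr prim).
apply/eqP; rewrite -addr_eq0; apply: contra_eqT (prim_expr_order prim) => nz.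
rewrite -subr_eq0.
have -> : xi ^+ 8 - 1 = (xi ^+ 4 - 1) * (xi ^+ 4 + 1) by ring.
by rewrite mulf_neq0 // subr_eq0.
Qed.

Lemma prim8_two_neq0 {K : fieldType} {xi : K} :
  8.-primitive_root xi -> 2 != 0 :> K.
Proof.
move=> prim; have : xi ^+ 4 != 1.
  by rewrite -(expr0 xi) (eq_prim_root_expr prim).
apply: contraNneq => two0; rewrite (prim8_expr4 prim) eq_sym -subr_eq0 opprK.
by rewrite -mulr2n two0.
Qed.

(* The tactic ring knows the morphism in_alg but not scaling. *)
Lemma scale_in_alg {K : fieldType} {A : comAlgType K} (k : K) (a : A) :
  k *: a = in_alg A k * a.
Proof. by rewrite mulr_algl. Qed.

Lemma omega_eta_basis {K : fieldType} {iota zeta : K} {A : comAlgType K}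
    {x y : A} (A_pres : is_presented zeta x y) (two_neq0 : 2 != 0 :> K)
    (j2 : (iota * zeta ^+ 2) ^+ 2 = -1) :
  is_basis (tnth (omega_eta iota zeta x y)).
Proof.
set j := iota * zeta ^+ 2 in j2.
pose c := 2^-1 * (1 + j); pose d := 2^-1 * (1 - j).
have unmix u v : (u * c + v * d) * d + (u * d + v * c) * c = u.
  have -> : (u * c + v * d) * d + (u * d + v * c) * c =
      u * (c * d *+ 2) + v * (c ^+ 2 + d ^+ 2) by ring.
  have -> : c * d *+ 2 = 2^-1 * (1 - j ^+ 2) by rewrite /c /d; field.
  have -> : c ^+ 2 + d ^+ 2 = 2^-1 * (1 + j ^+ 2) by rewrite /c /d; field.
  by rewrite j2 subrr opprK !mulr0 addr0 mulVf ?mulr1.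
have sumE (k : 'I_8 -> K) :
  \sum_(i < 8) k i *: tnth (omega_eta iota zeta x y) i =
  horner_alg x (Poly [:: k (inord 0);
      k (inord 1) * c + k (inord 2) * d; k (inord 3);
      k (inord 1) * d + k (inord 2) * c]) +
  horner_alg x (Poly [:: k (inord 4); k (inord 7); k (inord 6);
      k (inord 5)]) * y.
  rewrite !(horner_alg_wide _ 4) ?(leq_trans (size_Poly _)) //.
  under eq_bigr => i _ do rewrite (tnth_nth 0) -{1}[i]inord_val.
  rewrite !big_ord_recr !big_ord0 !coef_Poly /=.
  rewrite /omega1 /omega2 /omega3 /omega4 /eta1 /eta2 /eta3 /eta4.
  by rewrite -/j -/c -/d !scale_in_alg; ring.
split=> [k | v].
  rewrite sumE => /(presented_inj A_pres).
  case=> [||p0 q0]; rewrite ?(leq_trans (size_Poly _)) //.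
  move/polyP: p0 => p0; move/polyP: q0 => q0.
  have := (p0 0, p0 1, p0 2, p0 3, (q0 0, q0 1, q0 2, q0 3))%N.
  rewrite !coef_Poly !coef0 /= => -[[[[k0 p1] k3] p3] [[[k4 k7] k6] k5]].
  have k1 : k (inord 1) = 0.
    by rewrite -(unmix (k (inord 1)) (k (inord 2))) p1 p3; ring.
  have k2 : k (inord 2) = 0.
    rewrite -(unmix (k (inord 2)) (k (inord 1))).
    by rewrite (addrC (k (inord 2) * c)) p3 (addrC (k (inord 2) * d)) p1; ring.
  case=> i lti; rewrite -[Ordinal lti]inord_val /=.
  by case: i lti => [|[|[|[|[|[|[|[|i]]]]]]]].
have [p [q [szp szq ->]]] := presented_span A_pres v.
exists (fun i => [:: p`_0; p`_1 * d + p`_3 * c; p`_1 * c + p`_3 * d; p`_2;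
                   q`_0; q`_3; q`_2; q`_1]`_i).
rewrite sumE !inordK //.
congr (horner_alg x _ + horner_alg x _ * y).
  apply/polyP => i; rewrite coef_Poly.
  case: i => [|[|[|[|i]]]] //=.
  - rewrite -[LHS](unmix _ p`_3); ring.
  - rewrite -[LHS](unmix _ p`_1); ring.
  by rewrite !nth_default ?(leq_trans szp).
apply/polyP => i; rewrite coef_Poly.
case: i => [|[|[|[|i]]]] //=.
by rewrite !nth_default ?(leq_trans szq).
Qed.

Lemma big_V4 (V : nmodType) (F : V4 -> V) :
  \sum_g F g = F g1 + F g2 + F g3 + F g4.
Proof.
rewrite (eq_bigr (fun p => F (p.1, p.2))); last by case.
rewrite -(pair_bigA _ (fun i j => F (i, j))) /=.
rewrite !big_ord_recl !big_ord0 !addr0 /g1 /g2 /g3 /g4.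
have -> : lift ord0 ord0 = 1 :> 'Z_2 by apply: val_inj.
by rewrite -[ord0]/(0 : 'Z_2) !addrA (addrAC (F _)).
Qed.

Section BraidedProduct.

Set Implicit Arguments.
Unset Strict Implicit.

Variables (K : fieldType) (zeta : K) (A : comAlgType K) (x y : A).
Variables (act : V4 -> {lrmorphism A -> A}) (theta : V4 -> V4 -> K).
Variables (AA : algType K) (tens : {bilinear A -> A -> AA}).
Hypothesis two_neq0 : 2 != 0 :> K.
Hypothesis x4 : x ^+ 4 = 1.
Hypothesis act_spec : is_V4_action x y act.
Hypothesis theta_bichar : is_sym_bicharacter theta.
Hypothesis theta_spec : theta_values zeta theta.
Hypothesis AA_tensor : is_tensor_product tens.
Hypothesis AA_braided : is_braided_product act theta tens.

Lemma theta_g1r g : theta g g1 = 1.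
Proof.
have [nz _ _ addr] := theta_bichar.
apply: (mulfI (nz g g1)); rewrite -addr mulr1; congr (theta g _).
exact/eqP.
Qed.

Lemma theta_g4r g : theta g g4 = theta g g2 * theta g g3.
Proof.
have [_ _ _ addr] := theta_bichar; rewrite -addr; congr (theta g _).
exact/eqP.
Qed.

Lemma theta_sym g h : theta g h = theta h g.
Proof. by have [_ sym _ _] := theta_bichar. Qed.

Lemma coaction_g3_fixed b : act g3 b = b ->
  [/\ coaction act theta b g1 = 2^-1 *: (b + act g2 b),
      coaction act theta b g2 = 0,
      coaction act theta b g3 = 2^-1 *: (b - act g2 b)
    & coaction act theta b g4 = 0].
Proof.
have [act1 _ _ act4 _] := act_spec; have [t22 t23 t32 t33] := theta_spec.
move=> fix_b; rewrite /coaction !ffunE !big_V4 !act1 !act4 /= fix_b.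
rewrite !theta_g1r !theta_g4r !(theta_sym g1) !(theta_sym g4) !theta_g1r.
rewrite !theta_g4r t22 t23 t32 t33 !scale_in_alg.
have half : in_alg A 4^-1 * 2 = in_alg A 2^-1.
  have -> : 2^-1 = 4^-1 * 2 :> K.
    by field; rewrite two_neq0 (natrM _ 2 2) mulf_neq0.
  by rewrite rmorphM rmorph_nat.
by rewrite -half; split; ring.
Qed.

Lemma tens_mul_even a b a' b' : act g3 b = b -> act g2 b = b ->
  tens a b * tens a' b' = tens (a * a') (b * b').
Proof.
move=> fix3 fix2; have [c1 c2 c3 c4] := coaction_g3_fixed fix3.
have [act1 _ _ _ _] := act_spec.
rewrite AA_braided big_V4 c1 c2 c3 c4 act1 fix2 subrr scaler0.
rewrite !mul0r !linear0 !addr0 -mulr2n -scaler_nat scalerA mulVf //.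
by rewrite scale1r.
Qed.

Lemma tens_mul_odd a b a' b' : act g3 b = b -> act g2 b = - b ->
  tens a b * tens a' b' = tens (a * act g3 a') (b * b').
Proof.
move=> fix3 neg2; have [c1 c2 c3 c4] := coaction_g3_fixed fix3.
rewrite AA_braided big_V4 c1 c2 c3 c4 neg2 subrr scaler0 opprK.
rewrite !mul0r !linear0 !addr0 add0r -mulr2n -scaler_nat scalerA mulVf //.
by rewrite scale1r.
Qed.

Lemma tens11 : tens 1 1 = 1.
Proof.
have [F [_ uniqF]] := AA_tensor tens.
have mul1 u v : (tens 1 1 \*o idfun) (tens u v) = tens u v.
  by rewrite /= tens_mul_even ?rmorph1 // !mul1r.
by rewrite -[LHS]mulr1 [LHS](uniqF _ mul1) -(uniqF idfun).
Qed.

Let p : A := 2^-1 *: (x + x ^+ 3).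
Let m : A := 2^-1 *: (x - x ^+ 3).

Lemma in_alg_half_mul2 : in_alg A 2^-1 * 2 = 1.
Proof.
by rewrite -(rmorph_nat (in_alg A)) -rmorphM mulVf // rmorph1.
Qed.

Lemma p_plus_m : p + m = x.
Proof.
by rewrite /p /m !scale_in_alg -[RHS]mul1r -in_alg_half_mul2; ring.
Qed.

Lemma act_fix_p : act g3 p = p /\ act g2 p = p.
Proof.
have [_ [act2x _] [act3x _] _ _] := act_spec.
rewrite /p !linearZ !rmorphD !rmorphXn /= act2x act3x.
have -> : (x ^+ 3) ^+ 3 = x.
  by rewrite -exprM (exprD _ 4 5) (exprD _ 4 1) x4 !mul1r.
by rewrite [x + _]addrC.
Qed.

Lemma act_sign_m : act g3 m = m /\ act g2 m = - m.
Proof.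
have [_ [act2x _] [act3x _] _ _] := act_spec.
rewrite /m !linearZ !rmorphB !rmorphXn /= act2x act3x.
have -> : (x ^+ 3) ^+ 3 = x.
  by rewrite -exprM (exprD _ 4 5) (exprD _ 4 1) x4 !mul1r.
by rewrite opprB.
Qed.

Lemma act_fix_x2 : act g3 (x ^+ 2) = x ^+ 2 /\ act g2 (x ^+ 2) = x ^+ 2.
Proof.
have [_ [act2x _] [act3x _] _ _] := act_spec.
by rewrite !rmorphXn /= act2x act3x -exprM (exprD _ 4 2) x4 mul1r.
Qed.

Lemma x2_mul_p : x ^+ 2 * p = p.
Proof.
rewrite /p !scale_in_alg; transitivity (in_alg A 2^-1 * (x ^+ 3 + x ^+ 4 * x)).
  by ring.
by rewrite x4 mul1r addrC.
Qed.

Lemma x2_mul_m : x ^+ 2 * m = - m.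
Proof.
rewrite /m !scale_in_alg; transitivity (in_alg A 2^-1 * (x ^+ 3 - x ^+ 4 * x)).
  by ring.
by rewrite x4 mul1r; ring.
Qed.

Lemma p_mul_m : p * m = 0.
Proof.
rewrite /p /m !scale_in_alg.
transitivity (in_alg A 2^-1 ^+ 2 * x ^+ 2 * (1 - x ^+ 4)); first by ring.
by rewrite x4 subrr mulr0.
Qed.

Lemma p2_plus_m2 : p ^+ 2 + m ^+ 2 = x ^+ 2.
Proof.
have -> : p ^+ 2 + m ^+ 2 = (p + m) ^+ 2 - 2 * (p * m) by ring.
by rewrite p_plus_m p_mul_m mulr0 subr0.
Qed.

Variable Delta : {lrmorphism A -> AA}.
Hypothesis Delta_spec : is_coproduct x y tens Delta.

Lemma Delta_x : Delta x = tens x p + tens (x ^+ 3) m.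
Proof.
rewrite (proj1 Delta_spec) /p /m !linearZr /= linearDr linearBr -scalerDr /=.
by rewrite !addrA.
Qed.

Lemma Delta_x2 : Delta (x ^+ 2) = tens (x ^+ 2) (x ^+ 2).
Proof.
have [_ _ [act3x _] _ _] := act_spec.
have [p3 p2] := act_fix_p; have [m3 m2] := act_sign_m.
rewrite rmorphXn /= Delta_x expr2 mulrDl !mulrDr.
rewrite !(tens_mul_even _ (b := p)) // !(tens_mul_odd _ (b := m)) //.
rewrite !rmorphXn /= act3x [m * p]mulrC p_mul_m !linear0 addr0 add0r.
have -> : x ^+ 3 * x ^+ 3 = x * x by rewrite -exprD (exprD _ 4 2) x4 mul1r.
by rewrite -!expr2 -linearDr /= p2_plus_m2.
Qed.

Lemma Delta_x2_mul a a' b' :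
    Delta a = tens a' b' ->
  Delta (x ^+ 2 * a) = tens (x ^+ 2 * a') (x ^+ 2 * b').
Proof.
have [fix3 fix2] := act_fix_x2.
by move=> Da; rewrite rmorphM /= Delta_x2 Da tens_mul_even.
Qed.

Lemma Delta_xy : Delta (x * y) = tens (x * y) (x * y).
Proof.
have [_ _ [_ act3y] _ _] := act_spec.
have [p3 p2] := act_fix_p; have [m3 m2] := act_sign_m.
rewrite rmorphM /= Delta_x (proj2 Delta_spec) mulrDl.
rewrite tens_mul_even // tens_mul_odd // act3y.
have -> : x ^+ 3 * (x ^+ 2 * y) = x ^+ 4 * (x * y) by ring.
by rewrite x4 mul1r -linearDr /= -mulrDl p_plus_m.
Qed.

Lemma Delta_x3 : Delta (x ^+ 3) = tens (x ^+ 3) p - tens x m.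
Proof.
have [fix3 fix2] := act_fix_x2.
rewrite (exprD _ 2 1) rmorphM /= Delta_x2 Delta_x mulrDr !tens_mul_even //.
rewrite x2_mul_p x2_mul_m linearNr /= -exprSr -exprD.
by rewrite (exprD _ 4 1) x4 mul1r.
Qed.

Lemma Delta_omega (j : K) : j ^+ 2 = -1 ->
  let w := (2^-1 * (1 + j)) *: x + (2^-1 * (1 - j)) *: x ^+ 3 in
  Delta w = tens w w.
Proof.
move=> j2 w.
have w_pm : w = p + j *: m.
  by rewrite /w /p /m !scale_in_alg; ring.
have jw : j *: w = (2^-1 * (1 + j)) *: x ^+ 3 - (2^-1 * (1 - j)) *: x.
  rewrite /w scalerDr !scalerA addrC -scaleNr; congr (_ *: _ + _ *: _).
    rewrite mulrCA mulrBr mulr1 -expr2 j2; ring.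
  by rewrite mulrCA mulrDr mulr1 -expr2 j2; ring.
have -> : tens w w = tens w p + tens (j *: w) m.
  by rewrite {2}w_pm linearDr [tens w (j *: m)]linearZr linearZl.
have tensDZ a b s t u :
  tens (a *: s + b *: t) u = a *: tens s u + b *: tens t u.
  by rewrite linearDl !linearZl.
have DeltaDZ a b s t : Delta (a *: s + b *: t) = a *: Delta s + b *: Delta t.
  by rewrite linearD !linearZ.
rewrite jw -scaleNr tensDZ /w tensDZ DeltaDZ Delta_x Delta_x3.
by rewrite !scalerDr scalerN scaleNr addrACA.
Qed.

End BraidedProduct.

Theorem proposition2p4 (K : fieldType) (xi zeta : K)
    (xi_prim : 8.-primitive_root xi) (zeta4 : zeta ^+ 4 = 1)
    (A : comAlgType K) (x y : A) (A_pres : is_presented zeta x y)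
    (act : V4 -> {lrmorphism A -> A}) (act_spec : is_V4_action x y act)
    (theta : V4 -> V4 -> K) (theta_bichar : is_sym_bicharacter theta)
    (theta_spec : theta_values zeta theta)
    (AA : algType K) (tens : {bilinear A -> A -> AA})
    (AA_tensor : is_tensor_product tens)
    (AA_braided : is_braided_product act theta tens)
    (Delta : {lrmorphism A -> AA}) (Delta_spec : is_coproduct x y tens Delta)
    (eps : {lrmorphism A -> K^o}) (eps_spec : is_counit x y eps) :
  is_basis (tnth (omega_eta (xi ^+ 2) zeta x y)) /\
  (forall i, group_like tens Delta eps (tnth (omega_eta (xi ^+ 2) zeta x y) i)).
Proof.
have two_neq0 := prim8_two_neq0 xi_prim.
have x4 := presented_rel_x A_pres.
set j := xi ^+ 2 * zeta ^+ 2.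
have j2 : j ^+ 2 = -1.
  by rewrite exprMn -!exprM zeta4 mulr1 prim8_expr4.
have nj2 : (- j) ^+ 2 = -1 by rewrite sqrrN.
have [ex ey] := eps_spec.
split; first exact: omega_eta_basis.
have eps_omega (k : K) :
    eps ((2^-1 * (1 + k)) *: x + (2^-1 * (1 - k)) *: x ^+ 3) = 1.
  rewrite linearD !linearZ_LR rmorphXn /= ex expr1n.
  rewrite -[_ *: 1]/(_ * 1) -[X in _ + X]/(_ * 1) !mulr1 -mulrDr.
  by rewrite addrACA subrr addr0 -mulr2n mulVf.
have D_omega := Delta_omega two_neq0 x4 act_spec theta_bichar theta_spec
  AA_braided Delta_spec.
have D_x2 := Delta_x2 two_neq0 x4 act_spec theta_bichar theta_spec
  AA_braided Delta_spec.
have D_x2_mul := Delta_x2_mul two_neq0 x4 act_spec theta_bichar theta_spec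
  AA_braided Delta_spec.
have D_xy := Delta_xy two_neq0 x4 act_spec theta_bichar theta_spec
  AA_braided Delta_spec.
have D1 := tens11 two_neq0 act_spec theta_bichar theta_spec
  AA_tensor AA_braided.
case=> i lti; rewrite (tnth_nth 0) /=.
case: i lti => [|[|[|[|[|[|[|[|i]]]]]]]] //= _; split=> //.
- by rewrite rmorph1 /omega1.
- by rewrite rmorph1.
- exact: D_omega.
- exact: eps_omega.
- have := D_omega _ nj2; rewrite /= opprK; exact.
- have := eps_omega (- j); rewrite opprK; exact.
- by rewrite rmorphXn /= ex expr1n.
- exact: (proj2 Delta_spec).
- have := D_x2_mul _ _ _ D_xy; rewrite !mulrA -exprSr; exact.
- by rewrite rmorphM rmorphXn /= ex ey mulr1 expr1n.
- exact: D_x2_mul (proj2 Delta_spec).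
- by rewrite rmorphM rmorphXn /= ex ey mulr1 expr1n.
- by rewrite rmorphM /= ex ey mulr1.
Qed.
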